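(* Let $(J,g)$ be a metallic Riemannian structure on a smooth manifold $M$ with $J^2=pJ+qI$, $p,q\in\mathbb R$, let $\nabla$ be a linear connection on $M$ with torsion $T^\nabla$, and let $\hat J_c:=\begin{pmatrix} J & -(I+J^2)\sharp_g\\ \flat_g & -J^*\end{pmatrix}$ be the induced generalized complex structure on $TM\oplus T^*M$, i.e. $\hat J_c(X+\alpha)=JX-(I+J^2)\sharp_g\alpha+\flat_g X-J^*\alpha$. Write $g$ also for $\flat_g$. Then $\hat J_c$ is $\nabla$-integrable if and only if the following six conditions hold for all $X,Y\in C^\infty(TM)$: (1) $N_J(X,Y)+(I+J^2)\sharp_g\big((d^\nabla g)(X,Y)\big)=0$; (2) $(\nabla_{JX}g)Y-(\nabla_{JY}g)X+J^*\big((\nabla_Xg)Y-(\nabla_Yg)X\big)+g\big((\nabla_YJ)X-(\nabla_XJ)Y\big)+g\big(T^\nabla(X,JY)+T^\nabla(JX,Y)\big)=0$; (3) $(d^\nabla g)((I+J^2)Y,X)+(\nabla_XJ^* )g(JY)-(\nabla_{JX}J^* )g(Y)=0$; (4) $(\nabla_{(I+J^2)X}J^* )g(Y)-(\nabla_{(I+J^2)Y}J^* )g(X)=0$; (5) $(\nabla_{(I+J^2)X}J^2)Y-(\nabla_{(I+J^2)Y}J^2)X-T^\nabla((I+J^2)X,(I+J^2)Y)-(I+J^2)\sharp_g\big((\nabla_{(I+J^2)X}g)Y-(\nabla_{(I+J^2)Y}g)X\big)=0$; (6) $-(\nabla_{JX}J^2)Y+(\nabla_{(I+J^2)Y}J)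X-(\nabla_XJ)Y+J(\nabla_XJ^2)Y-J^2(\nabla_XJ)Y+(I+J^2)\sharp_g\big((\nabla_{JX}g)Y-(\nabla_Xg)JY\big)+T^\nabla(JX,(I+J^2)Y)-JT^\nabla(X,(I+J^2)Y)=0$.
   Context: A metallic Riemannian structure $(J,g)$ on $M$ consists of a $(1,1)$-tensor field $J$ with $J^2=pJ+qI$ ($p,q\in\mathbb R$) and a Riemannian metric $g$ with $g(JX,Y)=g(X,JY)$. $\flat_g:TM\to T^*M$, $\flat_g(X):=i_Xg=g(X,\cdot)$, and $\sharp_g$ is its inverse; $(J^*\alpha)(X):=\alpha(JX)$. $N_J(X,Y):=[JX,JY]-J[JX,Y]-J[X,JY]+J^2[X,Y]$. $T^\nabla(X,Y):=\nabla_XY-\nabla_YX-[X,Y]$. For a vector field $X$, $\nabla_Xg$ is regarded as a map $TM\to T^*M$, i.e. $(\nabla_Xg)Y:=\nabla_X(\flat_gY)-\flat_g(\nabla_XY)$, and $(d^\nabla g)(X,Y):=(\nabla_Xg)(Y)-(\nabla_Yg)(X)+g(T^\nabla(X,Y))\in C^\infty(T^*M)$. A generalized complex structure here means an endomorphism of $TM\oplus T^*M$ with square $-I$; $\hat J_c$ satisfies $\hat J_c^2=-I$. The bracket on $C^\infty(TM\oplus T^*M)$ is $[X+\alpha,Y+\beta]_\nabla:=[X,Y]+\nabla_X\beta-\nabla_Y\alpha$. An endomorphism $\hat J$ of $TM\oplus T^*M$ is $\nabla$-integrable if $N^\nabla_{\hat J}(\sigma,\tau):=[\hat J\sigma,\hat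 J\tau]_\nabla-\hat J[\hat J\sigma,\tau]_\nabla-\hat J[\sigma,\hat J\tau]_\nabla+\hat J^2[\sigma,\tau]_\nabla$ vanishes for all $\sigma,\tau\in C^\infty(TM\oplus T^*M)$. *)

(* Defs.v *)
From HB Require Import structures.
From mathcomp Require Import all_boot all_order all_algebra.
From mathcomp Require Import all_classical all_reals all_analysis.
Set Implicit Arguments.
Unset Strict Implicit.
Unset Printing Implicit Defensive.
Import Order.TTheory GRing.Theory Num.Theory.
Import numFieldNormedType.Exports.
Local Open Scope classical_set_scope.
Local Open Scope ring_scope.

Section SmoothReal.
Variables (R : realType) (n : nat).
Implicit Types (U : set 'rV[R]_n) (f g : 'rV[R]_n -> R).

(* All iterated partial derivatives of order at most k exist and are continuous
   on U. The set U is open in all uses, so that the values of f outside U are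
   irrelevant. *)
Fixpoint Ck_on (k : nat) U f : Prop :=
  (forall x, U x -> {for x, continuous f}) /\
  if k is k'.+1 then
    forall i : 'I_n, (forall x, U x -> derivable f x (delta_mx 0 i)) /\
                     Ck_on k' U ('D_(delta_mx 0 i) f)
  else True.

Definition smooth_on U f := forall k, Ck_on k U f.

Lemma Ck_on_le k U f : Ck_on k.+1 U f -> Ck_on k U f.
Proof.
elim: k f => [|k IHk] f [fC fD]; split=> // i.
by have [dF CF] := fD i; split=> //; apply: IHk.
Qed.

Lemma Ck_on_eq k U f g : open U -> (forall x, U x -> f x = g x) ->
  Ck_on k U f -> Ck_on k U g.
Proof.
move=> oU; elim: k f g => [|k IHk] f g fg [fC fD].
all: have nfg x (Ux : U x) : {near x, f =1 g} by
  apply: (filterS fg); exact: open_nbhs_nbhs.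
all: have gC x (Ux : U x) : {for x, continuous g} by
  rewrite /prop_for /continuous_at -(fg x Ux);
  exact: (cvg_trans (near_eq_cvg (nfg x Ux)) (fC x Ux)).
all: split=> // i; have [fd fk] := fD i.
split=> [x Ux|]; first exact: (near_eq_derivable (nfg x Ux) (fd x Ux)).
by apply: IHk fk => x Ux; exact: (near_eq_derive _ (nfg x Ux)).
Qed.

Lemma Ck_on_cst k U (a : R) : open U -> Ck_on k U (cst a).
Proof.
move=> oU; elim: k a => [|k IHk] a; split=> //.
1,2: by move=> x _; exact: cst_continuous.
move=> i; split=> [x _|]; first exact: derivable_cst.
by apply: (Ck_on_eq (f := cst 0)) (IHk 0) => // x _; rewrite derive_cst.
Qed.

Lemma Ck_onD k U f g : open U -> Ck_on k U f -> Ck_on k U g ->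
  Ck_on k U (f + g).
Proof.
move=> oU; elim: k f g => [|k IHk] f g [fC fD] [gC gD].
all: split=> //.
1,2: by move=> x Ux; apply: continuousD; [exact: fC|exact: gC].
move=> i; have [fd fk] := fD i; have [gd gk] := gD i; split=> [x Ux|].
  by apply: derivableD; [exact: fd|exact: gd].
apply: Ck_on_eq (IHk _ _ fk gk) => // x Ux.
by rewrite deriveD//; [exact: fd|exact: gd].
Qed.

Lemma Ck_onM k U f g : open U -> Ck_on k U f -> Ck_on k U g ->
  Ck_on k U (f * g).
Proof.
move=> oU; elim: k f g => [|k IHk] f g Cf Cg; have [fC fD] := Cf;
  have [gC gD] := Cg.
all: split=> //.
1,2: by move=> x Ux; apply: continuousM; [exact: fC|exact: gC].
move=> i; have [fd fk] := fD i; have [gd gk] := gD i; split=> [x Ux|].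
  by apply: derivableM; [exact: fd|exact: gd].
have := Ck_onD oU (IHk _ _ (Ck_on_le Cf) gk) (IHk _ _ (Ck_on_le Cg) fk).
apply: Ck_on_eq => // x Ux.
by rewrite [RHS]deriveM//; [exact: fd|exact: gd].
Qed.

End SmoothReal.

Record chart (R : realType) (n : nat) (T : topologicalType) := Chart {
  chart_dom : set T;
  chart_map :> T -> 'rV[R]_n;
  chart_inv : 'rV[R]_n -> T;
  chart_dom_open : open chart_dom;
  chart_codom_open : open (chart_map @` chart_dom);
  chart_mapK : forall x, chart_dom x -> chart_inv (chart_map x) = x;
  chart_map_cont : forall x, chart_dom x -> {for x, continuous chart_map};
  chart_inv_cont : forall y, (chart_map @` chart_dom) y ->
    {for y, continuous chart_inv} }.

Definition chart_codom R n T (c : chart R n T) : set 'rV[R]_n :=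
  c @` chart_dom c.

Definition smooth_transition R n T (c d : chart R n T) : Prop :=
  forall i : 'I_n, smooth_on (c @` (chart_dom c `&` chart_dom d))
                             (fun y => d (chart_inv c y) 0 i).

(* Smooth n-dimensional manifolds without boundary, given by a (not necessarily
   maximal) smooth atlas. *)
Record manifold (R : realType) (n : nat) := Manifold {
  mfd_carrier :> topologicalType;
  mfd_hausdorff : hausdorff_space mfd_carrier;
  mfd_second_countable : @second_countable mfd_carrier;
  mfd_index : Type;
  mfd_chart : mfd_index -> chart R n mfd_carrier;
  mfd_cover : forall x : mfd_carrier, exists a, chart_dom (mfd_chart a) x;
  mfd_compat : forall a b, smooth_transition (mfd_chart a) (mfd_chart b) }.

Section SmoothFunctions.
Variables (R : realType) (n : nat) (M : manifold R n).

Definition is_smooth (f : M -> R) : Prop :=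
  forall a : mfd_index M,
    smooth_on (chart_codom (mfd_chart a)) (f \o chart_inv (mfd_chart a)).

Definition smooth_pred : {pred M -> R} := fun f => `[< is_smooth f >].

Record smooth := Smooth {
  smooth_fun :> M -> R; _ : smooth_fun \in smooth_pred }.

HB.instance Definition _ := [isSub for smooth_fun].
HB.instance Definition _ := [Choice of smooth by <:].

Let codom_open (a : mfd_index M) : open (chart_codom (mfd_chart a)).
Proof. exact: chart_codom_open. Qed.

Lemma is_smooth_cst (c : R) : is_smooth (cst c).
Proof. by move=> a k; apply: Ck_on_cst; exact: codom_open. Qed.

Lemma is_smoothD f g : is_smooth f -> is_smooth g -> is_smooth (f + g).
Proof.
by move=> sf sg a k; apply: (Ck_onD (@codom_open a) (sf a k) (sg a k)).
Qed.

Lemma is_smoothM f g : is_smooth f -> is_smooth g -> is_smooth (f * g).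
Proof.
by move=> sf sg a k; apply: (Ck_onM (@codom_open a) (sf a k) (sg a k)).
Qed.

Lemma is_smoothN f : is_smooth f -> is_smooth (- f).
Proof.
move=> sf; have := is_smoothM (is_smooth_cst (-1)) sf.
by congr is_smooth; apply/funext => x; rewrite /GRing.mul/= mulN1r.
Qed.

Lemma smooth_subring : subring_closed smooth_pred.
Proof.
split=> [|f g|f g]; rewrite ?unfold_in.
- exact/asboolP/is_smooth_cst.
- by move=> /asboolP sf /asboolP sg; apply/asboolP/is_smoothD/is_smoothN.
- by move=> /asboolP sf /asboolP sg; exact/asboolP/is_smoothM.
Qed.

HB.instance Definition _ :=
  GRing.SubChoice_isSubComPzRing.Build (M -> R) smooth_pred smooth
    smooth_subring.

Lemma smooth_cst_subproof (c : R) : (cst c : M -> R) \in smooth_pred.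
Proof. exact/asboolP/is_smooth_cst. Qed.

Definition smooth_cst (c : R) : smooth := Smooth (smooth_cst_subproof c).

End SmoothFunctions.
Notation "''C^oo' ( M )" := (smooth M) (at level 8, format "''C^oo' ( M )").

(* Vector fields are the derivations of the R-algebra of smooth functions; the
   value of X at the point x is the tangent vector f |-> X f x. *)
Section VectorFields.
Variables (R : realType) (n : nat) (M : manifold R n).

Definition is_derivation (D : 'C^oo(M) -> 'C^oo(M)) : Prop :=
  [/\ forall f g, D (f + g) = D f + D g,
      forall (c : R) f, D (smooth_cst M c * f) = smooth_cst M c * D f &
      forall f g, D (f * g) = D f * g + f * D g].

Definition derivation_pred : {pred 'C^oo(M) -> 'C^oo(M)} :=
  fun D => `[< is_derivation D >].

Record vfield := VField {
  vfield_fun :> 'C^oo(M) -> 'C^oo(M); _ : vfield_fun \in derivation_pred }.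

HB.instance Definition _ := [isSub for vfield_fun].
HB.instance Definition _ := [Choice of vfield by <:].

Lemma vfieldP (X : vfield) : is_derivation X.
Proof. by case: X => D /= /asboolP. Qed.

Lemma derivation_zmod : zmod_closed derivation_pred.
Proof.
split=> [|D E]; rewrite ?unfold_in.
  by apply/asboolP; split=> *; rewrite /= ?addr0 ?mulr0 ?mul0r ?addr0.
move=> /asboolP[DD DZ DM] /asboolP[ED EZ EM]; apply/asboolP.
have DE f : (D - E) f = D f - E f by [].
split=> [f g|c f|f g]; rewrite !DE.
- by rewrite DD ED opprD addrACA.
- by rewrite DZ EZ mulrBr.
- by rewrite DM EM mulrBl mulrBr opprD addrACA.
Qed.

HB.instance Definition _ :=
  GRing.SubChoice_isSubZmodule.Build ('C^oo(M) -> 'C^oo(M)) derivation_pred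
    vfield derivation_zmod.

Lemma vfield_scale_subproof (h : 'C^oo(M)) (X : vfield) :
  (fun f => h * X f) \in derivation_pred.
Proof.
have [XD XZ XM] := vfieldP X; rewrite unfold_in; apply/asboolP.
split=> [f g|c f|f g].
- by rewrite XD mulrDr.
- by rewrite XZ mulrCA.
- by rewrite XM mulrDr mulrA (mulrCA h f).
Qed.

Definition vfield_scale (h : 'C^oo(M)) (X : vfield) : vfield :=
  VField (vfield_scale_subproof h X).

Lemma vfieldE (X Y : vfield) : (forall f, X f = Y f) -> X = Y.
Proof. by move=> XY; apply/val_inj/funext. Qed.

Lemma vfield_scaleA h k X :
  vfield_scale h (vfield_scale k X) = vfield_scale (h * k) X.
Proof. by apply: vfieldE => f /=; rewrite mulrA. Qed.

Lemma vfield_scale1 : left_id 1 vfield_scale.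
Proof. by move=> X; apply: vfieldE => f /=; rewrite mul1r. Qed.

Lemma vfield_scaleDr : right_distributive vfield_scale +%R.
Proof. by move=> h X Y; apply: vfieldE => f /=; rewrite mulrDr. Qed.

Lemma vfield_scaleDl X :
  {morph vfield_scale^~ X : h k / h + k >-> h + k}.
Proof. by move=> h k; apply: vfieldE => f /=; rewrite mulrDl. Qed.

HB.instance Definition _ := GRing.Zmodule_isLmodule.Build 'C^oo(M) vfield
  vfield_scaleA vfield_scale1 vfield_scaleDr vfield_scaleDl.

Let lie_reorder (V : zmodType) (a b c d a' d' : V) :
  a + b + (c + d) - (a' + c + (b + d')) = a - a' + (d - d').
Proof.
have -> : a + b + (c + d) = (a + d) + (b + c) by rewrite (addrC c) addrACA.
have -> : a' + c + (b + d') = (a' + d') + (b + c).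
  by rewrite (addrC b d') addrACA (addrC c).
by rewrite opprD (addrACA (a + d)) subrr addr0 opprD addrACA.
Qed.

Lemma lie_subproof (X Y : vfield) :
  (fun f => X (Y f) - Y (X f)) \in derivation_pred.
Proof.
have [XD XZ XM] := vfieldP X; have [YD YZ YM] := vfieldP Y.
rewrite unfold_in; apply/asboolP; split=> [f g|c f|f g].
- by rewrite YD XD XD YD opprD addrACA.
- by rewrite YZ XZ XZ YZ mulrBr.
- by rewrite YM XM XD YD !XM !YM mulrBl mulrBr lie_reorder.
Qed.

Definition lie (X Y : vfield) : vfield := VField (lie_subproof X Y).

End VectorFields.

(* Differential 1-forms, i.e. sections of T^*M, are the 'C^oo(M)-linear maps
   from vector fields to smooth functions. *)
Section Forms.
Variables (R : realType) (n : nat) (M : manifold R n).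

Definition is_oneform (a : vfield M -> 'C^oo(M)) : Prop :=
  forall (h : 'C^oo(M)) X Y, a (h *: X + Y) = h * a X + a Y.

Definition oneform_pred : {pred vfield M -> 'C^oo(M)} := fun a => `[< is_oneform a >].

Record oneform := OneForm {
  form_fun :> vfield M -> 'C^oo(M); _ : form_fun \in oneform_pred }.

HB.instance Definition _ := [isSub for form_fun].
HB.instance Definition _ := [Choice of oneform by <:].

Lemma oneformP (a : oneform) : is_oneform a.
Proof. by case: a => a /= /asboolP. Qed.

Lemma oneformD (a : oneform) X Y : a (X + Y) = a X + a Y.
Proof. by rewrite -[X in a (X + _)]scale1r oneformP mul1r. Qed.

Lemma oneform0 (a : oneform) : a 0 = 0.
Proof. by apply: (@addrI _ (a 0)); rewrite -oneformD !addr0. Qed.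

Lemma oneformZ (a : oneform) h X : a (h *: X) = h * a X.
Proof. by rewrite -[h *: X]addr0 oneformP oneform0 addr0. Qed.

Lemma oneform_zmod : zmod_closed oneform_pred.
Proof.
split=> [|a b]; rewrite ?unfold_in.
  by apply/asboolP => h X Y; rewrite /= mulr0 addr0.
move=> /asboolP la /asboolP lb; apply/asboolP => h X Y.
have ab Z : (a - b) Z = a Z - b Z by [].
by rewrite !ab la lb mulrBr opprD addrACA.
Qed.

HB.instance Definition _ :=
  GRing.SubChoice_isSubZmodule.Build (vfield M -> 'C^oo(M)) oneform_pred
    oneform oneform_zmod.

End Forms.

Section Connections.
Variables (R : realType) (n : nat) (M : manifold R n).

Record connection := Connection {
  nabla :> vfield M -> vfield M -> vfield M;
  nablaP : forall (h : 'C^oo(M)) X Y Z,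
    nabla (h *: X + Y) Z = h *: nabla X Z + nabla Y Z;
  nablaD : forall X Y Z, nabla X (Y + Z) = nabla X Y + nabla X Z;
  nabla_leibniz : forall X (f : 'C^oo(M)) Y,
    nabla X (f *: Y) = X f *: Y + f *: nabla X Y }.

Definition torsion (D : connection) (X Y : vfield M) : vfield M :=
  D X Y - D Y X - lie X Y.

Lemma form_nabla_subproof (D : connection) (X : vfield M) (b : oneform M) :
  (fun Y => X (b Y) - b (D X Y)) \in @oneform_pred R n M.
Proof.
have [XD _ XM] := vfieldP X; rewrite unfold_in; apply/asboolP => h Y Z.
rewrite nablaD nabla_leibniz !oneformD !oneformZ XD XM.
rewrite opprD addrACA; congr (_ + _).
by rewrite opprD addrACA subrr add0r -mulrBr.
Qed.

(* The connection induced on T^*M. *)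
Definition form_nabla (D : connection) (X : vfield M) (b : oneform M) :
    oneform M :=
  OneForm (form_nabla_subproof D X b).

(* (nabla_X A) s := nabla_X (A s) - A (nabla_X s), the covariant derivative of
   a bundle map A : E -> F for connections DE on E and DF on F. *)
Definition covder (E F : zmodType) (DE : vfield M -> E -> E)
    (DF : vfield M -> F -> F) (X : vfield M) (A : E -> F) (s : E) : F :=
  DF X (A s) - A (DE X s).

End Connections.

Section Metallic.
Variables (R : realType) (n : nat) (M : manifold R n).

Record riemannian := Riemannian {
  metric_fun :> vfield M -> vfield M -> 'C^oo(M);
  metric_sym : forall X Y, metric_fun X Y = metric_fun Y X;
  metricP : forall (h : 'C^oo(M)) X Y Z,
    metric_fun (h *: X + Y) Z = h * metric_fun X Z + metric_fun Y Z;
  (* the hypothesis says that the tangent vector of X at x is nonzero *)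
  metric_pos : forall (X : vfield M) (x : M),
    (exists f : 'C^oo(M), X f x != 0) -> 0 < metric_fun X X x }.

Lemma flat_subproof (g : riemannian) (X : vfield M) :
  g X \in @oneform_pred R n M.
Proof.
rewrite unfold_in; apply/asboolP => h Y Z.
by rewrite !(metric_sym g X) metricP.
Qed.

Definition flat (g : riemannian) (X : vfield M) : oneform M :=
  OneForm (flat_subproof g X).

Definition is_sharp (g : riemannian) (sharp : oneform M -> vfield M) : Prop :=
  cancel (flat g) sharp /\ cancel sharp (flat g).

Implicit Types (J : {linear vfield M -> vfield M}) (D : connection M).

Definition metallic (p q : R) J (g : riemannian) : Prop :=
  (forall X, J (J X) = smooth_cst M p *: J X + smooth_cst M q *: X) /\
  (forall X Y, g (J X) Y = g X (J Y)).

Lemma dual_subproof J (a : oneform M) : (a \o J) \in @oneform_pred R n M.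
Proof.
by rewrite unfold_in; apply/asboolP => h X Y; rewrite /= linearP oneformP.
Qed.

Definition dual_end J (a : oneform M) : oneform M :=
  OneForm (dual_subproof J a).

Definition nijenhuis J (X Y : vfield M) : vfield M :=
  lie (J X) (J Y) - J (lie (J X) Y) - J (lie X (J Y)) + J (J (lie X Y)).

Definition nabla_end D X (A : vfield M -> vfield M) (Y : vfield M) : vfield M :=
  covder D D X A Y.

Definition nabla_dual D X J (a : oneform M) : oneform M :=
  covder (form_nabla D) (form_nabla D) X (dual_end J) a.

Definition nabla_metric D X (g : riemannian) (Y : vfield M) : oneform M :=
  covder D (form_nabla D) X (flat g) Y.

Definition ext_nabla D (g : riemannian) (X Y : vfield M) : oneform M :=
  nabla_metric D X g Y - nabla_metric D Y g X + flat g (torsion D X Y).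

(* Sections of the direct sum of TM and T^*M. *)
Local Notation gsection := (vfield M * oneform M)%type.

Definition gbracket D (s t : gsection) : gsection :=
  (lie s.1 t.1, form_nabla D s.1 t.2 - form_nabla D t.1 s.2).

Definition gnijenhuis D (A : gsection -> gsection) (s t : gsection) :
    gsection :=
  gbracket D (A s) (A t) - A (gbracket D (A s) t) - A (gbracket D s (A t))
  + A (A (gbracket D s t)).

Definition nabla_integrable D (A : gsection -> gsection) : Prop :=
  forall s t, gnijenhuis D A s t = 0.

Definition IJ2 J (X : vfield M) : vfield M := X + J (J X).

Definition J_c J (g : riemannian) (sharp : oneform M -> vfield M)
    (s : gsection) : gsection :=
  (J s.1 - IJ2 J (sharp s.2), flat g s.1 - dual_end J s.2).

End Metallic.

(* Main.v *)
Require Import Defs.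
From HB Require Import structures.
From mathcomp Require Import all_boot all_order all_algebra.
From mathcomp Require Import all_classical all_reals all_analysis.
From mathcomp Require Import ring.
Import GRing.Theory.
Local Open Scope ring_scope.

(** Write K for I + J^2. The Nijenhuis expression of an additive endomorphism A
    of the sections of TM + T^*M is biadditive and skew-symmetric, because the
    bracket is; so it vanishes identically as soon as it vanishes on the pairs
    tangent-tangent, tangent-cotangent and cotangent-cotangent
    ([gnijenhuis_eq0]). As flat is invertible, every 1-form is of the
    shape flat Z, so each of the three types of pairs is parametrized by two
    vector fields X and Y. The value on each type has a component in TM and a
    component in T^*M: these are the six conditions.

    On fields and flattened fields the structure reads
    X |-> (J X, flat X) and flat Z |-> (- K Z, - flat (J Z)), the second one
    because g-symmetry of J says that J^* flat = flat J; it also follows that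
    the square is - I ([J_c_sqr]), which turns the last term of the Nijenhuis
    expression into minus the bracket. Expanding the definition then gives
    expressions in Lie brackets of fields and covariant derivatives of
    flattened fields only:
<<
      (X, 0), (Y, 0)           : conditions (1) and (2)
      (X, 0), (0, flat Y)      : conditions (6) and (3)
      (0, flat X), (0, flat Y) : conditions (5) and (4)
>>
    The conditions involve in addition derivatives of g, J, J^2 and J^* and the
    torsion. When these are expanded, every covariant derivative of a vector
    field cancels and the torsion leaves only its Lie bracket; this is the
    content of [ext_nablaE], [tangent_formE], [mixed_formE], [cotangent_formE],
    [cotangent_fieldE] and [mixed_fieldE]. Comparing the two expansions shows
    that the components are exactly the left-hand sides of the conditions
    ([gnijenhuis_tangent], [gnijenhuis_mixed], [gnijenhuis_cotangent]). *)

Set Implicit Arguments.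
Unset Strict Implicit.
Unset Printing Implicit Defensive.

(** * Additivity of the operators *)

Section Evaluation.
Variables (R : realType) (n : nat) (M : manifold R n).
Implicit Types (X Y Z : vfield M) (a b : oneform M) (D : connection M).

Lemma vfield_addE X Y f : (X + Y) f = X f + Y f. Proof. by []. Qed.
Lemma vfield_oppE X f : (- X) f = - X f. Proof. by []. Qed.
Lemma vfield_zeroE f : (0 : vfield M) f = 0. Proof. by []. Qed.

Lemma oneform_ext a b : (forall X, a X = b X) -> a = b.
Proof. by move=> ab; apply/val_inj/funext. Qed.
Lemma oneform_addE a b X : (a + b) X = a X + b X. Proof. by []. Qed.
Lemma oneform_oppE a X : (- a) X = - a X. Proof. by []. Qed.
Lemma oneform_zeroE X : (0 : oneform M) X = 0. Proof. by []. Qed.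

Lemma lieE X Y f : lie X Y f = X (Y f) - Y (X f). Proof. by []. Qed.
Lemma form_nablaE D X a Y : form_nabla D X a Y = X (a Y) - a (D X Y).
Proof. by []. Qed.

Definition vfield_evalE := (vfield_addE, vfield_oppE, vfield_zeroE).
Definition oneform_evalE := (oneform_addE, oneform_oppE, oneform_zeroE).

End Evaluation.

(** Vector fields and 1-forms take values in the commutative ring of smooth
    functions, where [ring] decides identities between sums; evaluating both
    sides at an arbitrary argument thus decides them for the fields and forms. *)
Ltac zmod_ring :=
  first [ apply: vfieldE => ?; rewrite ?vfield_evalE
        | apply: oneform_ext => ?; rewrite ?oneform_evalE ]; ring.

Section Operators.
Variables (R : realType) (n : nat) (M : manifold R n).
Implicit Types (X Y Z : vfield M) (a b : oneform M) (D : connection M).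
Implicit Types (J : {linear vfield M -> vfield M}) (g : riemannian M).

Lemma vfield_additive X : zmod_morphism X.
Proof.
have [XD _ _] := vfieldP X => f h.
by apply: (@addIr _ (X h)); rewrite -XD !subrK.
Qed.

HB.instance Definition _ X :=
  GRing.isZmodMorphism.Build (smooth M) (smooth M) X (vfield_additive X).

Lemma oneform_additive a : zmod_morphism a.
Proof. by move=> X Y; apply: (@addIr _ (a Y)); rewrite -oneformD !subrK. Qed.

HB.instance Definition _ a :=
  GRing.isZmodMorphism.Build (vfield M) (smooth M) a (oneform_additive a).

Lemma nabla_additive D X : zmod_morphism (D X).
Proof.
by move=> Y Z; apply: (@addIr _ (D X Z)); rewrite -nablaD !subrK.
Qed.

HB.instance Definition _ D X :=
  GRing.isZmodMorphism.Build (vfield M) (vfield M) (D X) (nabla_additive D X).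

Lemma form_nabla_additive D X : zmod_morphism (form_nabla D X).
Proof.
move=> a b; apply: oneform_ext => Y; rewrite !(oneform_evalE, form_nablaE).
by rewrite raddfB; ring.
Qed.

HB.instance Definition _ D X :=
  GRing.isZmodMorphism.Build (oneform M) (oneform M) (form_nabla D X)
    (form_nabla_additive D X).

Lemma flat_additive g : zmod_morphism (flat g).
Proof.
move=> X Y; apply: oneform_ext => Z.
rewrite !oneform_evalE /= !(Defs.metric_sym g _ Z).
exact: (raddfB (flat g Z)).
Qed.

HB.instance Definition _ g :=
  GRing.isZmodMorphism.Build (vfield M) (oneform M) (flat g) (flat_additive g).

Lemma dual_end_additive J : zmod_morphism (dual_end J).
Proof. by move=> a b; apply: oneform_ext. Qed.

HB.instance Definition _ J :=
  GRing.isZmodMorphism.Build (oneform M) (oneform M) (dual_end J)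
    (dual_end_additive J).

Lemma IJ2_additive J : zmod_morphism (IJ2 J).
Proof. by move=> X Y; rewrite /IJ2 !raddfB /=; zmod_ring. Qed.

HB.instance Definition _ J :=
  GRing.isZmodMorphism.Build (vfield M) (vfield M) (IJ2 J) (IJ2_additive J).

Lemma nabla_addl D X Y Z : D (X + Y) Z = D X Z + D Y Z.
Proof. by rewrite -[X]scale1r nablaP !scale1r. Qed.

Lemma form_nabla_addl D X Y b :
  form_nabla D (X + Y) b = form_nabla D X b + form_nabla D Y b.
Proof.
apply: oneform_ext => Z.
by rewrite !(oneform_evalE, form_nablaE) vfield_evalE nabla_addl raddfD; ring.
Qed.

Lemma lie_addl X Y Z : lie (X + Y) Z = lie X Z + lie Y Z.
Proof.
by apply: vfieldE => f; rewrite !(vfield_evalE, lieE) raddfD; ring.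
Qed.

Lemma lie_antisym X Y : lie Y X = - lie X Y.
Proof. by apply: vfieldE => f; rewrite vfield_evalE !lieE opprB. Qed.

Lemma lie0l X : lie 0 X = 0.
Proof. by apply: (@addrI _ (lie 0 X)); rewrite -lie_addl !addr0. Qed.

Lemma lie0r X : lie X 0 = 0.
Proof. by rewrite lie_antisym lie0l oppr0. Qed.

Lemma lie_oppl X Y : lie (- X) Y = - lie X Y.
Proof. by apply: (@addrI _ (lie X Y)); rewrite -lie_addl !subrr lie0l. Qed.

Lemma lie_oppr X Y : lie X (- Y) = - lie X Y.
Proof. by rewrite lie_antisym lie_oppl -lie_antisym. Qed.

Lemma form_nabla0l D b : form_nabla D 0 b = 0.
Proof.
by apply: (@addrI _ (form_nabla D 0 b)); rewrite -form_nabla_addl !addr0.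
Qed.

Lemma form_nabla_oppl D X b : form_nabla D (- X) b = - form_nabla D X b.
Proof.
apply: (@addrI _ (form_nabla D X b)).
by rewrite -form_nabla_addl !subrr form_nabla0l.
Qed.

End Operators.

(** * The generalized Nijenhuis expression *)

Section GeneralizedNijenhuis.
Variables (R : realType) (n : nat) (M : manifold R n) (D : connection M).
Local Notation gsection := (vfield M * oneform M)%type.
Variable (A : {additive gsection -> gsection}).
Implicit Types s t u : gsection.

Lemma gbracket_addl s t u :
  gbracket D (s + t) u = gbracket D s u + gbracket D t u.
Proof.
rewrite /gbracket /= lie_addl form_nabla_addl raddfD /=.
by congr (_, _) => /=; zmod_ring.
Qed.

Lemma gbracket_antisym s t : gbracket D t s = - gbracket D s t.
Proof. by rewrite /gbracket lie_antisym -opprB. Qed.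

Lemma gnijenhuis_addl s t u :
  gnijenhuis D A (s + t) u = gnijenhuis D A s u + gnijenhuis D A t u.
Proof.
have sum4D (a b c d a' b' c' d' : gsection) :
    a + a' - (b + b') - (c + c') + (d + d')
    = (a - b - c + d) + (a' - b' - c' + d').
  by rewrite !opprD (addrACA a) (addrACA (a - b)) (addrACA (a - b - c)).
rewrite /gnijenhuis -sum4D.
by rewrite (raddfD A s) !gbracket_addl 3!(raddfD A) (raddfD A (A _)).
Qed.

Lemma gnijenhuis_antisym s t : gnijenhuis D A t s = - gnijenhuis D A s t.
Proof.
rewrite /gnijenhuis !(gbracket_antisym _ t) !(gbracket_antisym _ (A t)).
rewrite !(raddfN A) /=.
by rewrite !opprD !opprK (addrAC _ (A (gbracket D s (A t)))).
Qed.

Lemma gnijenhuis_addr s t u :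
  gnijenhuis D A s (t + u) = gnijenhuis D A s t + gnijenhuis D A s u.
Proof.
by rewrite gnijenhuis_antisym gnijenhuis_addl opprD -!gnijenhuis_antisym.
Qed.

(** Skew-symmetry takes care of the cotangent-tangent pairs. *)
Lemma gnijenhuis_eq0 :
  (forall X Y, gnijenhuis D A (X, 0) (Y, 0) = 0) ->
  (forall X b, gnijenhuis D A (X, 0) (0, b) = 0) ->
  (forall a b, gnijenhuis D A (0, a) (0, b) = 0) ->
  nabla_integrable D A.
Proof.
move=> NTT NTF NFF [X a] [Y b].
have split Z c : (Z, c) = (Z, 0) + (0, c) :> gsection.
  by congr (_, _); rewrite /= ?addr0 ?add0r.
rewrite (split X) (split Y) gnijenhuis_addl !gnijenhuis_addr.
by rewrite NTT NTF NFF (gnijenhuis_antisym (Y, 0)) NTF oppr0 !addr0.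
Qed.

End GeneralizedNijenhuis.

(** * The six conditions as components of the Nijenhuis expression *)

Section Conditions.
Variables (R : realType) (n : nat) (M : manifold R n).
Variables (J : {linear vfield M -> vfield M}) (g : riemannian M).
Variables (sharp : {additive oneform M -> vfield M}) (D : connection M).
Hypothesis J_sym : forall X Y, g (J X) Y = g X (J Y).
Hypothesis flatK : cancel (flat g) sharp.
Implicit Types X Y Z : vfield M.
Local Notation gsection := (vfield M * oneform M)%type.

Lemma J_c_additive : zmod_morphism (J_c J g sharp : gsection -> gsection).
Proof.
move=> s t; rewrite /J_c /= !raddfB /=.
by congr (_, _) => /=; zmod_ring.
Qed.

HB.instance Definition _ :=
  GRing.isZmodMorphism.Build gsection gsection (J_c J g sharp) J_c_additive.

(** The compatibility of J and g enters the proof in this form. It moves J^*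
    across flat, so that the structure preserves the description of forms as
    flattened vector fields. *)
Lemma dual_end_flat X : dual_end J (flat g X) = flat g (J X).
Proof. by apply: oneform_ext => Y /=; rewrite J_sym. Qed.

(** The torsion absorbs the derivatives of X and Y, as in the exterior
    differential of flat, seen as a 1-form with values in T^*M. *)
Lemma ext_nablaE X Y : ext_nabla D g X Y =
  form_nabla D X (flat g Y) - form_nabla D Y (flat g X) - flat g (lie X Y).
Proof.
by rewrite /ext_nabla /nabla_metric /covder /torsion !raddfB /=; zmod_ring.
Qed.

(** In each of the next five lemmas the right-hand side is a component of the
    Nijenhuis expression of the generalized structure, and the left-hand side
    the condition that it encodes; here the T^*M-component on two vector fields.
    Under flat, nabla_X (J Y) cancels between the derivative of J and the
    torsion, nabla_(J X) Y between the derivative of g and the torsion, and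
    J (nabla_X Y) between the derivatives of g and J; likewise with X and Y
    exchanged. *)
Lemma tangent_formE X Y :
  nabla_metric D (J X) g Y - nabla_metric D (J Y) g X
  + dual_end J (nabla_metric D X g Y - nabla_metric D Y g X)
  + flat g (nabla_end D Y J X - nabla_end D X J Y)
  + flat g (torsion D X (J Y) + torsion D (J X) Y)
  = form_nabla D (J X) (flat g Y) - form_nabla D (J Y) (flat g X)
    + dual_end J (form_nabla D X (flat g Y) - form_nabla D Y (flat g X))
    - flat g (lie X (J Y) + lie (J X) Y).
Proof.
rewrite /nabla_metric /nabla_end /torsion /covder.
rewrite !(raddfB (dual_end J)) /= !dual_end_flat !(raddfB (flat g)).
by rewrite !(raddfD (flat g)) !(raddfN (flat g)) /=; zmod_ring.
Qed.

(* K is expanded only where it is differentiated or applied to a derivative or a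
   bracket; as the direction of a derivative it may stay whole. *)
Let IJ2E X : IJ2 J X = X + J (J X).
Proof. by []. Qed.

Let flat_IJ2 Y : flat g (IJ2 J Y) = flat g Y + flat g (J (J Y)).
Proof. exact: raddfD. Qed.

Let nabla_IJ2 X Y : D X (IJ2 J Y) = D X Y + D X (J (J Y)).
Proof. exact: raddfD. Qed.

(** With J^* flat = flat J, the term J^* (flat (J Y)) is flat (J^2 Y); it cancels
    the part J^2 of K in nabla_X (flat (K Y)). *)
Lemma mixed_formE X Y :
  ext_nabla D g (IJ2 J Y) X + nabla_dual D X J (flat g (J Y))
  - nabla_dual D (J X) J (flat g Y)
  = form_nabla D (IJ2 J Y) (flat g X) - form_nabla D X (flat g Y)
    - form_nabla D (J X) (flat g (J Y))
    + dual_end J (form_nabla D (J X) (flat g Y))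
    - dual_end J (form_nabla D X (flat g (J Y))) + flat g (lie X (IJ2 J Y)).
Proof.
rewrite ext_nablaE /nabla_dual /covder !dual_end_flat flat_IJ2 raddfD /=.
rewrite (lie_antisym X) raddfN /=; zmod_ring.
Qed.

Lemma cotangent_formE X Y :
  nabla_dual D (IJ2 J X) J (flat g Y) - nabla_dual D (IJ2 J Y) J (flat g X)
  = form_nabla D (IJ2 J X) (flat g (J Y))
    - form_nabla D (IJ2 J Y) (flat g (J X))
    - dual_end J (form_nabla D (IJ2 J X) (flat g Y))
    + dual_end J (form_nabla D (IJ2 J Y) (flat g X)).
Proof. by rewrite /nabla_dual /covder !dual_end_flat; zmod_ring. Qed.

(** In the direction K X, the torsion contributes - nabla (K Y) and the derivative
    of g contributes K (nabla Y). Together they are - (nabla K) Y, which cancels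
    (nabla J^2) Y because K and J^2 differ by the parallel endomorphism I; the
    direction K Y is the same with X and Y exchanged. *)
Lemma cotangent_fieldE X Y :
  nabla_end D (IJ2 J X) (J \o J) Y - nabla_end D (IJ2 J Y) (J \o J) X
  - torsion D (IJ2 J X) (IJ2 J Y)
  - IJ2 J (sharp (nabla_metric D (IJ2 J X) g Y - nabla_metric D (IJ2 J Y) g X))
  = lie (IJ2 J X) (IJ2 J Y)
    - IJ2 J (sharp (form_nabla D (IJ2 J X) (flat g Y)
                    - form_nabla D (IJ2 J Y) (flat g X))).
Proof.
rewrite /nabla_end /torsion /nabla_metric /covder /= !nabla_IJ2.
rewrite !(raddfB sharp) /= !flatK !(raddfB (IJ2 J)) /= !(IJ2E (D _ _)).
by zmod_ring.
Qed.

(** The derivatives along J X cancel as in [cotangent_fieldE], and those along K Y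
    cancel between (nabla_(K Y) J) X and the two torsions. Those along X combine
    to J (nabla_X (J^2 Y)) + J (nabla_X Y) - J (nabla_X (K Y)) and
    K (nabla_X (J Y)) - nabla_X (J Y) - J^2 (nabla_X (J Y)), both zero. *)
Lemma mixed_fieldE X Y :
  - nabla_end D (J X) (J \o J) Y + nabla_end D (IJ2 J Y) J X
  - nabla_end D X J Y + J (nabla_end D X (J \o J) Y)
  - J (J (nabla_end D X J Y))
  + IJ2 J (sharp (nabla_metric D (J X) g Y - nabla_metric D X g (J Y)))
  + torsion D (J X) (IJ2 J Y) - J (torsion D X (IJ2 J Y))
  = J (lie X (IJ2 J Y)) - lie (J X) (IJ2 J Y)
    + IJ2 J (sharp (form_nabla D (J X) (flat g Y)
                    - form_nabla D X (flat g (J Y)))).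
Proof.
rewrite /nabla_end /torsion /nabla_metric /covder /= !nabla_IJ2.
rewrite !(raddfB sharp) /= !flatK !(raddfB (IJ2 J)) /= !(IJ2E (D _ _)).
by rewrite !(raddfB J) !(raddfD J) /=; zmod_ring.
Qed.

Hypothesis sharpK : cancel sharp (flat g).

Lemma J_c_sqr s : J_c J g sharp (J_c J g sharp s) = - s.
Proof.
case: s => X a; rewrite -(sharpK a); move: (sharp a) => Z.
rewrite /J_c /= !(raddfB, raddfN) /= !dual_end_flat !flatK /IJ2 !raddfD /=.
by congr (_, _) => /=; zmod_ring.
Qed.

Lemma J_c_tangent X : J_c J g sharp (X, 0) = (J X, flat g X).
Proof. by rewrite /J_c /= !raddf0 /= !addr0. Qed.

Lemma J_c_flat Z :
  J_c J g sharp (0, flat g Z) = (- IJ2 J Z, - flat g (J Z)).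
Proof. by rewrite /J_c /= !raddf0 /= flatK dual_end_flat !add0r. Qed.

Lemma gnijenhuis_tangent X Y :
  gnijenhuis D (J_c J g sharp) (X, 0) (Y, 0) =
  (nijenhuis J X Y + IJ2 J (sharp (ext_nabla D g X Y)),
   nabla_metric D (J X) g Y - nabla_metric D (J Y) g X
   + dual_end J (nabla_metric D X g Y - nabla_metric D Y g X)
   + flat g (nabla_end D Y J X - nabla_end D X J Y)
   + flat g (torsion D X (J Y) + torsion D (J X) Y)).
Proof.
rewrite tangent_formE ext_nablaE /nijenhuis /gnijenhuis J_c_sqr !J_c_tangent.
rewrite /gbracket /= !raddf0 !(sub0r, addr0) /J_c /= ?raddf0.
rewrite !(raddfB sharp) !(raddfN sharp) /= !flatK !(raddfB (dual_end J)).
rewrite (raddfD (flat g)) (raddfN (dual_end J)) !(raddfB (IJ2 J)).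
rewrite (raddfN (IJ2 J)) /= !(IJ2E (lie _ _)).
by congr (_, _) => /=; zmod_ring.
Qed.

Lemma gnijenhuis_mixed X Y :
  gnijenhuis D (J_c J g sharp) (X, 0) (0, flat g Y) =
  (- nabla_end D (J X) (J \o J) Y + nabla_end D (IJ2 J Y) J X
   - nabla_end D X J Y + J (nabla_end D X (J \o J) Y)
   - J (J (nabla_end D X J Y))
   + IJ2 J (sharp (nabla_metric D (J X) g Y - nabla_metric D X g (J Y)))
   + torsion D (J X) (IJ2 J Y) - J (torsion D X (IJ2 J Y)),
   ext_nabla D g (IJ2 J Y) X + nabla_dual D X J (flat g (J Y))
   - nabla_dual D (J X) J (flat g Y)).
Proof.
rewrite mixed_formE mixed_fieldE /gnijenhuis J_c_sqr J_c_tangent J_c_flat.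
rewrite /gbracket /= !lie0r !form_nabla0l !lie_oppr !form_nabla_oppl.
rewrite !raddf0 ?addr0 /J_c /= !(raddfB, raddfN, raddf0) /=.
by congr (_, _) => /=; zmod_ring.
Qed.

Lemma gnijenhuis_cotangent X Y :
  gnijenhuis D (J_c J g sharp) (0, flat g X) (0, flat g Y) =
  (nabla_end D (IJ2 J X) (J \o J) Y - nabla_end D (IJ2 J Y) (J \o J) X
   - torsion D (IJ2 J X) (IJ2 J Y)
   - IJ2 J (sharp (nabla_metric D (IJ2 J X) g Y
                   - nabla_metric D (IJ2 J Y) g X)),
   nabla_dual D (IJ2 J X) J (flat g Y) - nabla_dual D (IJ2 J Y) J (flat g X)).
Proof.
rewrite cotangent_formE cotangent_fieldE /gnijenhuis J_c_sqr !J_c_flat.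
rewrite /gbracket /= !lie_oppr !lie_oppl !(lie0l, lie0r).
rewrite !(form_nabla0l, form_nabla_oppl) /J_c /= !oppr0 !addr0 !add0r !opprK.
rewrite !(raddf0 J) !(raddf0 (flat g)) !(raddfN (form_nabla D _)).
rewrite !(raddfN sharp) !(raddfB sharp) !(raddfN (dual_end J)).
rewrite !(raddfN (IJ2 J)) !(raddfB (IJ2 J)) /=.
by congr (_, _) => /=; zmod_ring.
Qed.

End Conditions.

Lemma pair_eq0 (U V : zmodType) (u : U) (v : V) :
  (u, v) = 0 -> u = 0 /\ v = 0.
Proof. by case. Qed.

Theorem proposition2p17 (R : realType) (n : nat) (M : manifold R n) (p q : R)
    (J : {linear vfield M -> vfield M}) (g : riemannian M)
    (sharp : oneform M -> vfield M) (D : connection M)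
    (hJg : metallic p q J g) (hsharp : is_sharp g sharp) :
  nabla_integrable D (J_c J g sharp) <->
  forall X Y : vfield M,
    [/\ nijenhuis J X Y + IJ2 J (sharp (ext_nabla D g X Y)) = 0,
        nabla_metric D (J X) g Y - nabla_metric D (J Y) g X
        + dual_end J (nabla_metric D X g Y - nabla_metric D Y g X)
        + flat g (nabla_end D Y J X - nabla_end D X J Y)
        + flat g (torsion D X (J Y) + torsion D (J X) Y) = 0,
        ext_nabla D g (IJ2 J Y) X + nabla_dual D X J (flat g (J Y))
        - nabla_dual D (J X) J (flat g Y) = 0 &
    [/\ nabla_dual D (IJ2 J X) J (flat g Y)
        - nabla_dual D (IJ2 J Y) J (flat g X) = 0,
        nabla_end D (IJ2 J X) (J \o J) Y - nabla_end D (IJ2 J Y) (J \o J) X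
        - torsion D (IJ2 J X) (IJ2 J Y)
        - IJ2 J (sharp (nabla_metric D (IJ2 J X) g Y
                        - nabla_metric D (IJ2 J Y) g X)) = 0 &
        - nabla_end D (J X) (J \o J) Y + nabla_end D (IJ2 J Y) J X
        - nabla_end D X J Y + J (nabla_end D X (J \o J) Y)
        - J (J (nabla_end D X J Y))
        + IJ2 J (sharp (nabla_metric D (J X) g Y - nabla_metric D X g (J Y)))
        + torsion D (J X) (IJ2 J Y) - J (torsion D X (IJ2 J Y)) = 0]].
Proof.
have [_ J_sym] := hJg; have [flatK sharpK] := hsharp.
(* As the inverse of flat, sharp is additive; bundled as such, it makes the
   generalized structure an additive endomorphism. *)
have [sh shE] : exists sh : {additive oneform M -> vfield M}, sharp = sh.
  have sharp_additive := can2_zmod_morphism flatK sharpK.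
  pose sh : {additive oneform M -> vfield M} :=
    HB.pack sharp (GRing.isZmodMorphism.Build _ _ sharp sharp_additive).
  by exists sh.
subst sharp.
have tangent := gnijenhuis_tangent D J_sym flatK sharpK.
have mixed := gnijenhuis_mixed D J_sym flatK sharpK.
have cotangent := gnijenhuis_cotangent D J_sym flatK sharpK.
split=> [NA X Y | conds].
  have := NA (X, 0) (Y, 0); rewrite tangent => /pair_eq0[c1 c2].
  have := NA (X, 0) (0, flat g Y); rewrite mixed => /pair_eq0[c6 c3].
  have := NA (0, flat g X) (0, flat g Y).
  rewrite cotangent => /pair_eq0[c5 c4].
  by split=> //; split.
apply: gnijenhuis_eq0 => [X Y | X b | a b].
- by rewrite tangent; have [-> ->] := conds X Y.
- by rewrite -(sharpK b) mixed; have [_ _ -> [_ _ ->]] := conds X (sh b).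
- rewrite -(sharpK a) -(sharpK b) cotangent.
  by have [_ _ _ [-> -> _]] := conds (sh a) (sh b).
Qed.
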